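(* Let $(a_{ij})_{i,j=1}^r$ be the Cartan matrix of a complex simple Lie algebra and $d_i$ coprime positive integers with $d_ia_{ij}=d_ja_{ji}$. Equip $(\mathbb C^\times)^{2r}$, with coordinates $\chi^\pm_1,\dots,\chi^\pm_r$, with the Poisson bracket $$\{\chi^+_i,\chi^+_j\}=\{\chi^-_i,\chi^-_j\}=0,\qquad \{\chi^+_i,\chi^-_j\}=-2d_ia_{ij}\chi^+_i\chi^-_j .$$ Then the map $\alpha$, defined outside the hypersurfaces $\chi^-_j=1$ by $$\alpha(\chi^+_i)=\chi^-_i,\qquad \alpha(\chi^-_i)=\frac{(\chi^-_i)^2}{\chi^+_i}\prod_{j=1}^r(1-\chi^-_j)^{-a_{ji}},$$ is a Poisson map.
   Context: A map $\alpha$ is Poisson if $\{f\circ\alpha,g\circ\alpha\}=\{f,g\}\circ\alpha$ for all functions $f,g$. The Cartan matrix convention is $a_{ji}=2(\alpha_i,\alpha_j)/(\alpha_j,\alpha_j)$ for simple roots $\alpha_i$. *)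

(* Defs.v *)
(* The complex numbers are R[i] for R : realType. *)
From HB Require Import structures.
From mathcomp Require Import all_boot all_order all_algebra.
From mathcomp Require Import all_classical all_reals all_analysis.
From mathcomp Require Export complex.

Set Implicit Arguments.
Unset Strict Implicit.
Unset Printing Implicit Defensive.

Import Order.TTheory GRing.Theory Num.Theory.
Import numFieldNormedType.Exports.

Local Open Scope classical_set_scope.
Local Open Scope ring_scope.

Section Lie.
Variables (F : fieldType) (L : vectType F) (br : L -> L -> L).

Record lie_bracket : Prop := LieBracket {
  lie_linearl : forall y, linear (br^~ y);
  lie_linearr : forall x, linear (br x);
  lie_alternating : forall x, br x x = 0;
  lie_jacobi : forall x y z, br x (br y z) + br y (br z x) + br z (br x y) = 0
}.

(* [U, V]: by bilinearity the brackets of basis vectors span it. *)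
Definition lie_commutator (U V : {vspace L}) : {vspace L} :=
  <<[seq br u v | u <- vbasis U, v <- vbasis V]>>%VS.

Definition lie_subalgebra (U : {vspace L}) : Prop :=
  {in U &, forall x y, br x y \in U}.

Definition lie_ideal (U : {vspace L}) : Prop :=
  forall x y, y \in U -> br x y \in U.

Definition simple_lie_algebra : Prop :=
  [/\ lie_bracket,
      exists x y, br x y != 0 &
      forall U, lie_ideal U -> U = 0%VS \/ U = fullv].

Definition lie_nilpotent (U : {vspace L}) : Prop :=
  exists n, iter n (lie_commutator U) U = 0%VS.

(* A nilpotent subalgebra that is its own normalizer. *)
Definition cartan_subalgebra (H : {vspace L}) : Prop :=
  [/\ lie_subalgebra H, lie_nilpotent H &
      forall x, {in H, forall h, br x h \in H} -> x \in H].

(* The trace of ad x \o ad y, computed in a basis of L. *)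
Definition killing_form (x y : L) : F :=
  \sum_(k < \dim {:L})
    coord (vbasis {:L}) k (br x (br y (tnth (vbasis {:L}) k))).

Definition lie_root (H : {vspace L}) (beta : 'Hom(subvs_of H, F^o)) : Prop :=
  beta != 0 /\
  exists2 x : L, x != 0 &
    forall h : subvs_of H, br (vsval h) x = beta h *: x.

Definition simple_roots (H : {vspace L}) (r : nat)
    (alpha : r.-tuple 'Hom(subvs_of H, F^o)) : Prop :=
  [/\ basis_of fullv alpha,
      forall i, lie_root (tnth alpha i) &
      forall beta, lie_root beta -> exists n : 'I_r -> nat,
        beta = \sum_i tnth alpha i *+ n i \/
        beta = - (\sum_i tnth alpha i *+ n i)].

End Lie.

(* The inner product of roots is the one transported from the Killing form:
   (alpha_i, alpha_j) = killing_form (t_i) (t_j), where t_i in H represents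
   alpha_i; its normalization does not affect A. *)
Definition simple_cartan_matrix (F : fieldType) (r : nat) (A : 'M[int]_r) :
    Prop :=
  exists (L : vectType F) (br : L -> L -> L) (H : {vspace L})
    (alpha : r.-tuple 'Hom(subvs_of H, F^o)) (t : 'I_r -> subvs_of H),
  [/\ simple_lie_algebra br,
      cartan_subalgebra br H,
      simple_roots br alpha,
      forall i (h : subvs_of H),
        killing_form br (vsval (t i)) (vsval h) = tnth alpha i h &
      forall i j, (A j i)%:~R =
        2 * killing_form br (vsval (t i)) (vsval (t j))
          / killing_form br (vsval (t j)) (vsval (t j)) :> F].

Section Poisson.
Variables (K : numFieldType) (n : nat).
Implicit Types (P : 'rV[K]_n -> 'M[K]_n) (f g : 'rV[K]_n -> K).

(* Over K = R[i], differentiability is complex differentiability. *)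
Definition holomorphic_on (W : normedModType K) (V : set 'rV[K]_n)
    (f : 'rV[K]_n -> W) : Prop :=
  forall x, V x -> differentiable f x.

Definition pderiv (a : 'I_n) f (x : 'rV[K]_n) : K := 'D_(delta_mx 0 a) f x.

(* P x a b is the bracket at x of the a-th and b-th coordinates. *)
Definition poisson_bracket P f g (x : 'rV[K]_n) : K :=
  \sum_a \sum_b P x a b * pderiv a f x * pderiv b g x.

(* A map from U to M, both open, is tested on all functions holomorphic on
   some open V included in M; V = M gives the global functions. *)
Definition poisson_map P (U M : set 'rV[K]_n) (phi : 'rV[K]_n -> 'rV[K]_n) :
    Prop :=
  [/\ forall x, U x -> M (phi x),
      holomorphic_on U phi &
      forall (V : set 'rV[K]_n) f g,
        open V -> V `<=` M ->
        holomorphic_on V f -> holomorphic_on V g ->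
        forall x, U x -> V (phi x) ->
          poisson_bracket P (f \o phi) (g \o phi) x =
          poisson_bracket P f g (phi x)].

Lemma poisson_bracket_coord P (a b : 'I_n) (x : 'rV[K]_n) :
  poisson_bracket P (fun y => y 0 a) (fun y => y 0 b) x = P x a b.
Proof.
have dc c e : pderiv c (fun y : 'rV[K]_n => y 0 e) x = (c == e)%:R.
  apply: (@cvg_lim K); first exact: norm_hausdorff.
  apply: (@cvg_near_cst K) => //; near=> h.
  have h0 : h != 0 by near: h; exact: nbhs_dnbhs_neq.
  rewrite /= !mxE eqxx andTb addrK eq_sym.
  by rewrite /GRing.scale /= mulrA mulVf // mul1r.
rewrite /poisson_bracket (bigD1 a) //= (bigD1 b) //= !dc !eqxx !mulr1.
rewrite big1 => [|c cb]; last by rewrite !dc (negbTE cb) mulr0.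
rewrite big1 ?addr0 // => c ca; apply: big1 => e _.
by rewrite dc (negbTE ca) mulr0 mul0r.
Unshelve. all: by end_near.
Qed.

End Poisson.

Section ChiCoordinates.
Variables (K : numFieldType) (r : nat).
Implicit Types x : 'rV[K]_(r + r).

Definition chi_p (i : 'I_r) x : K := x 0 (lshift r i).
Definition chi_m (i : 'I_r) x : K := x 0 (rshift r i).

Definition torus : set 'rV[K]_(r + r) := [set x | forall k, x 0 k != 0].

Definition chi_tensor (A : 'M[int]_r) (d : 'I_r -> nat) x : 'M[K]_(r + r) :=
  let B := \matrix_(i, j)
    (- 2 * (d i)%:R * (A i j)%:~R * chi_p i x * chi_m j x) in
  block_mx 0 B (- B^T) 0.

Definition alpha_domain : set 'rV[K]_(r + r) :=
  [set x | torus x /\ forall j, chi_m j x != 1].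

Definition alpha_map (A : 'M[int]_r) x : 'rV[K]_(r + r) :=
  row_mx (\row_i chi_m i x)
         (\row_i (chi_m i x ^+ 2 / chi_p i x *
                  \prod_j (1 - chi_m j x) ^ (- A j i))).

Lemma bracket_chi_pp A d i j x :
  poisson_bracket (chi_tensor A d) (chi_p i) (chi_p j) x = 0.
Proof. by rewrite poisson_bracket_coord block_mxEul mxE. Qed.

Lemma bracket_chi_mm A d i j x :
  poisson_bracket (chi_tensor A d) (chi_m i) (chi_m j) x = 0.
Proof. by rewrite poisson_bracket_coord block_mxEdr mxE. Qed.

Lemma bracket_chi_pm A d i j x :
  poisson_bracket (chi_tensor A d) (chi_p i) (chi_m j) x =
  - 2 * (d i)%:R * (A i j)%:~R * chi_p i x * chi_m j x.
Proof. by rewrite poisson_bracket_coord block_mxEur mxE. Qed.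

Lemma bracket_chi_mp A d i j x :
  poisson_bracket (chi_tensor A d) (chi_m i) (chi_p j) x =
  - poisson_bracket (chi_tensor A d) (chi_p j) (chi_m i) x.
Proof.
by rewrite !poisson_bracket_coord block_mxEdl block_mxEur !mxE.
Qed.

End ChiCoordinates.

(* Main.v *)
(* In logarithmic coordinates the bracket has constant coefficients, so it is
   enough to compare the logarithmic gradients of the components of alpha.
   Write b i j = 2 d_i a_ij, a symmetric matrix, so that
   {log chi^+_i, log chi^-_j} = - b i j.  Since
     log alpha(chi^-_j) = 2 log chi^-_j - log chi^+_j
                          - sum_k a_kj log (1 - chi^-_k),
   only the term - log chi^+_j contributes to the bracket of
   log alpha(chi^+_i) = log chi^-_i with it, which is - b i j.  The bracket of
   log alpha(chi^-_i) and log alpha(chi^-_j) is 2 (q i j - q j i), where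
     - 2 q i j = {log chi^+_i, log alpha(chi^-_j)},
     q i j = b i j + sum_k d_i a_ik a_kj chi^-_k / (1 - chi^-_k);
   as d_i a_ik = d_k a_ki, q is symmetric. *)
From HB Require Import structures.
Require Import Defs.
From mathcomp Require Import all_boot all_order all_algebra.
From mathcomp Require Import all_classical all_reals all_analysis.
From mathcomp Require Import ring.

Local Open Scope ring_scope.

Import Order.TTheory GRing.Theory Num.Theory.
Import numFieldNormedType.Exports.

(** * Gradients, the coordinate criterion for Poisson maps, and the calculus of logarithmic
    gradients *)

Section Gradient.
Set Implicit Arguments.
Unset Strict Implicit.
Variables (K : numFieldType) (n : nat).
Implicit Types (P : 'rV[K]_n -> 'M[K]_n) (f g : 'rV[K]_n -> K) (x : 'rV[K]_n).

Definition grad f x : 'rV[K]_n := \row_a pderiv a f x.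

Lemma poisson_bracketE P f g x :
  poisson_bracket P f g x = (grad f x *m P x *m (grad g x)^T) 0 0.
Proof.
rewrite mxE /poisson_bracket exchange_big /=; apply: eq_bigr => b _.
rewrite !mxE mulr_suml; apply: eq_bigr => a _.
by rewrite !mxE [P x a b * _]mulrC.
Qed.

Lemma diff_coord (b : 'I_n) x v : 'd (fun y : 'rV[K]_n => y 0 b) x v = v 0 b.
Proof.
have lf : linear (fun y : 'rV[K]_n => y 0 b) by move=> k y z; rewrite !mxE.
pose h : {linear 'rV[K]_n -> K} := HB.pack (fun y : 'rV[K]_n => y 0 b)
  (GRing.isLinear.Build _ _ _ _ _ lf).
have -> // : 'd h x = h :> ('rV[K]_n -> K).
apply: diff_lin => y; exact/differentiable_continuous/differentiable_coord.
Qed.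

Lemma diff_coord_comp (phi : 'rV[K]_n -> 'rV[K]_n) (c : 'I_n) x v :
  differentiable phi x -> 'd (fun y => phi y 0 c) x v = 'd phi x v 0 c.
Proof.
move=> dphi; rewrite -[RHS](diff_coord c (phi x)).
exact: (congr1 (@^~ v) (diff_comp dphi (differentiable_coord (phi x) 0 c))).
Qed.

Lemma grad_coord (b : 'I_n) x : grad (fun y => y 0 b) x = delta_mx 0 b.
Proof.
apply/rowP => a; rewrite mxE /pderiv deriveE; last exact: differentiable_coord.
by rewrite diff_coord !mxE eqxx eq_sym.
Qed.

Lemma grad_comp f (phi : 'rV[K]_n -> 'rV[K]_n) x :
  differentiable phi x -> differentiable f (phi x) ->
  grad (f \o phi) x =
  \sum_c pderiv c f (phi x) *: grad (fun y => phi y 0 c) x.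
Proof.
move=> dphi df; apply/rowP => a; rewrite summxE mxE /pderiv.
rewrite deriveE; last exact: differentiable_comp.
rewrite diff_comp //= [in LHS](row_sum_delta ('d phi x _)) linear_sum /=.
apply: eq_bigr => c _; rewrite linearZ /= !mxE /pderiv.
rewrite deriveE // deriveE; last first.
  exact: (differentiable_comp dphi (differentiable_coord _ _ _)).
rewrite [RHS]mulrC; congr (_ * _); exact/esym/(diff_coord_comp c _ dphi).
Qed.

Lemma differentiable_row (phi : 'rV[K]_n -> 'rV[K]_n) x :
  (forall c, differentiable (fun y => phi y 0 c) x) -> differentiable phi x.
Proof.
move=> dphi.
have -> : phi = \sum_c (fun y => phi y 0 c *: delta_mx 0 c).
  by apply/funext => y; rewrite fct_sumE -row_sum_delta.
by apply: differentiable_sum => c; apply: differentiableZl.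
Qed.

(** By the chain rule, both brackets are the same bilinear expression in the partial derivatives of
    [f] and [g] at [phi x], so agreement on pairs of coordinates is enough. *)
Lemma poisson_map_coord P U M (phi : 'rV[K]_n -> 'rV[K]_n) :
  (forall x, U x -> M (phi x)) ->
  (forall x, U x -> forall c, differentiable (fun y => phi y 0 c) x) ->
  (forall x, U x -> forall c e,
    poisson_bracket P (fun y => phi y 0 c) (fun y => phi y 0 e) x =
    P (phi x) c e) ->
  poisson_map P U M phi.
Proof.
move=> UM dphi Pphi; split=> // [x Ux | V f g _ _ hf hg x Ux Vx].
  exact/differentiable_row/dphi.
have dx : differentiable phi x by exact/differentiable_row/dphi.
rewrite poisson_bracketE !grad_comp //; [|exact: hg|exact: hf].
rewrite !mulmx_suml summxE; apply: eq_bigr => c _.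
rewrite [(\sum_c0 _)^T]linear_sum mulmx_sumr summxE; apply: eq_bigr => e _.
rewrite -Pphi // poisson_bracketE linearZ /= -!scalemxAl -scalemxAr !mxE.
by rewrite mulrA mulrC mulrA.
Qed.

(** [l] plays the role of the gradient of log [f]; multiplying through by [f x] avoids choosing a
    branch of the logarithm. *)
Definition log_grad f x (l : 'rV[K]_n) : Prop :=
  differentiable f x /\ grad f x = f x *: l.

Lemma log_grad_bracket P f g x l m : log_grad f x l -> log_grad g x m ->
  poisson_bracket P f g x = f x * g x * (l *m P x *m m^T) 0 0.
Proof.
move=> [_ fl] [_ gm]; rewrite poisson_bracketE fl gm linearZ /=.
by rewrite -!scalemxAl -scalemxAr !mxE mulrA.
Qed.

Lemma log_grad_cst (k : K) x : log_grad (cst k) x 0.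
Proof.
split; first exact: differentiable_cst.
by apply/rowP => a; rewrite !mxE /pderiv derive_cst mulr0.
Qed.

Lemma log_gradM f g x l m : log_grad f x l -> log_grad g x m ->
  log_grad (fun y => f y * g y) x (l + m).
Proof.
move=> [df fl] [dg gm]; split; first exact: (differentiableM df dg).
apply/rowP => a; rewrite mxE /pderiv deriveM; try exact: diff_derivable.
move/rowP/(_ a): fl; move/rowP/(_ a): gm; rewrite !mxE /pderiv => -> ->.
rewrite /GRing.scale /=; ring.
Qed.

Lemma log_gradV f x l : f x != 0 -> log_grad f x l ->
  log_grad (fun y => (f y)^-1) x (- l).
Proof.
move=> f0 [df fl]; split; first exact: differentiableV.
apply/rowP => a; rewrite mxE /pderiv deriveV //; last exact: diff_derivable.
move/rowP/(_ a): fl; rewrite !mxE /pderiv => ->.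
by rewrite /GRing.scale /=; field.
Qed.

Lemma log_gradX f x l k : log_grad f x l ->
  log_grad (fun y => f y ^+ k) x (l *+ k).
Proof.
move=> fl; elim: k => [|k IH].
  rewrite mulr0n; under eq_fun => y do rewrite expr0.
  exact: log_grad_cst.
by rewrite mulrS; under eq_fun => y do rewrite exprS; exact: log_gradM.
Qed.

Lemma log_gradXz f x l (z : int) : f x != 0 -> log_grad f x l ->
  log_grad (fun y => f y ^ z) x (l *~ z).
Proof.
move=> f0 fl; case: z => k; first exact: log_gradX.
(* [Negz k] is the integer -(k+1), hence the exponent [k.+1]. *)
apply: (@log_gradV (fun y => f y ^+ k.+1)); first by rewrite expf_neq0.
exact: log_gradX.
Qed.

Lemma log_grad_prod (I : Type) (s : seq I) (F : I -> 'rV[K]_n -> K) x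
    (l : I -> 'rV[K]_n) : (forall i, log_grad (F i) x (l i)) ->
  log_grad (fun y => \prod_(i <- s) F i y) x (\sum_(i <- s) l i).
Proof.
move=> Fl; elim: s => [|i s IH].
  rewrite big_nil; under eq_fun => y do rewrite big_nil.
  exact: log_grad_cst.
by rewrite big_cons; under eq_fun => y do rewrite big_cons; exact: log_gradM.
Qed.

Lemma log_grad_coord (b : 'I_n) x : x 0 b != 0 ->
  log_grad (fun y => y 0 b) x ((x 0 b)^-1 *: delta_mx 0 b).
Proof.
move=> x0; split; first exact: differentiable_coord.
by rewrite grad_coord scalerA divff // scale1r.
Qed.

Lemma log_grad_1Bcoord (b : 'I_n) x : x 0 b != 1 ->
  log_grad (fun y => 1 - y 0 b) x (- ((1 - x 0 b)^-1 *: delta_mx 0 b)).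
Proof.
move=> x1; have d1 := @differentiable_cst K _ K (1 : K) x.
have db := @differentiable_coord K 1 n x 0 b.
split; first exact: (differentiableB d1 db).
rewrite scalerN scalerA divff ?subr_eq0 1?eq_sym // scale1r -(grad_coord b x).
apply/rowP => a; rewrite !mxE /pderiv deriveB; try exact: diff_derivable.
by rewrite derive_cst sub0r.
Qed.

End Gradient.

(** * Logarithmic gradients of the components of alpha *)

Section ChiMutation.
Set Implicit Arguments.
Unset Strict Implicit.
Variables (K : numFieldType) (r : nat) (A : 'M[int]_r) (d : 'I_r -> nat).
Hypothesis d_sym : forall i j, (d i)%:Z * A i j = (d j)%:Z * A j i.
Variable x : 'rV[K]_(r + r).
Hypothesis Ux : @alpha_domain K r x.

Let chi_p_neq0 i : chi_p i x != 0. Proof. by case: Ux => + _; apply. Qed.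
Let chi_m_neq0 i : chi_m i x != 0. Proof. by case: Ux => + _; apply. Qed.
Let chi_m_neq1 i : chi_m i x != 1. Proof. by case: Ux => _; apply. Qed.
Let subr_chi_m_neq0 i : 1 - chi_m i x != 0.
Proof. by rewrite subr_eq0 eq_sym. Qed.

Lemma alpha_map_torus : torus (alpha_map A x).
Proof.
rewrite /torus /= => k.
rewrite -(splitK k); case: (fintype.split k) => i /=;
  rewrite ?row_mxEl ?row_mxEr mxE //.
rewrite !mulf_neq0 ?invr_neq0 ?expf_neq0 //.
by apply/prodf_neq0 => j _; rewrite expfz_neq0.
Qed.

Definition log_alpha_p (i : 'I_r) : 'rV[K]_r := (chi_m i x)^-1 *: delta_mx 0 i.

(** The chi^- half of the gradient of log alpha(chi^-_i). The second term is positive: the exponent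
    -a_ki and the derivative of 1 - chi^-_k each contribute a minus sign. *)
Definition log_alpha_m (i : 'I_r) : 'rV[K]_r :=
  \row_k (2 * (k == i)%:R / chi_m k x + (A k i)%:~R / (1 - chi_m k x)).

Lemma log_grad_alpha_p i :
  log_grad (fun y => alpha_map A y 0 (lshift r i)) x (row_mx 0 (log_alpha_p i)).
Proof.
under eq_fun => y do rewrite row_mxEl mxE.
have -> : row_mx 0 (log_alpha_p i) =
          (chi_m i x)^-1 *: delta_mx 0 (rshift r i).
  apply/rowP => k; rewrite -(splitK k); case: (fintype.split k) => j /=.
    by rewrite row_mxEl !mxE eq_lrshift mulr0.
  by rewrite row_mxEr !mxE eq_rshift.
exact: (log_grad_coord (chi_m_neq0 i)).
Qed.

Lemma log_grad_alpha_m i :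
  log_grad (fun y => alpha_map A y 0 (rshift r i)) x
    (row_mx (- ((chi_p i x)^-1 *: delta_mx 0 i)) (log_alpha_m i)).
Proof.
under eq_fun => y do rewrite row_mxEr mxE.
have lp := log_gradV (chi_p_neq0 i) (log_grad_coord (chi_p_neq0 i)).
have lm := log_gradX 2 (log_grad_coord (chi_m_neq0 i)).
have lS j := log_gradXz (- A j i) (subr_chi_m_neq0 j)
  (log_grad_1Bcoord (chi_m_neq1 j)).
have := log_gradM (log_gradM lm lp) (log_grad_prod (index_enum _) lS).
congr (log_grad _ _ _); apply/rowP => k.
rewrite -(splitK k); case: (fintype.split k) => j /=.
  (* In the chi^+ directions only the factor 1/chi^+_i contributes. *)
  rewrite row_mxEl !mxE summxE big1 => [|l _].
    rewrite !(eq_lshift, eq_lrshift) eqxx /= mulr0 add0r sub0r addr0.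
    by rewrite /chi_p.
  by rewrite mulrNz mulNrz opprK -scaler_int !mxE eq_lrshift !mulr0.
(* In the direction chi^-_j only the j-th factor of the product survives, together with the square
   of chi^-_i when j = i. *)
rewrite row_mxEr !mxE summxE (bigD1 j) //= big1 => [|l lj].
  rewrite mulrNz mulNrz opprK -scaler_int !mxE !(eq_rshift, eq_rlshift) eqxx.
  rewrite /= mulr0 oppr0 !addr0 [j == j]eqxx mulr1.
  rewrite /chi_m; case: eqP => [->|_]; last first.
    by rewrite !mulr0 mul0r addr0.
  by rewrite !mulr1 mulr_natl mulr2n.
rewrite mulrNz mulNrz opprK -scaler_int !mxE eq_rshift eq_sym (negbTE lj).
by rewrite !mulr0.
Qed.

(** * Pairings of these gradients under the Poisson tensor *)

Let B : 'M[K]_r := \matrix_(i, j)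
  (- 2 * (d i)%:R * (A i j)%:~R * chi_p i x * chi_m j x).

Lemma chi_tensor_pairing (a b a' b' : 'rV[K]_r) :
  row_mx a b *m chi_tensor A d x *m (row_mx a' b')^T =
  a *m B *m b'^T - b *m B^T *m a'^T.
Proof.
rewrite mul_row_block tr_row_mx mul_row_col !mulmx0 add0r addr0.
by rewrite mulmxN mulNmx addrC.
Qed.

Let symK i j : (d i)%:R * (A i j)%:~R = (d j)%:R * (A j i)%:~R :> K.
Proof.
by have /(congr1 (fun z : int => z%:~R : K)) := d_sym i j; rewrite !rmorphM.
Qed.

(** Here d_k a_ki replaces d_i a_ik, which makes each summand visibly symmetric in i and j. *)
Let q i j := \sum_k (d k)%:R * (A k i)%:~R * (A k j)%:~R * chi_m k x
                     / (1 - chi_m k x)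
             + 2 * ((d i)%:R * (A i j)%:~R).

Let qC i j : q i j = q j i.
Proof. by rewrite /q symK; congr (_ + _); apply: eq_bigr => k _; ring. Qed.

(** [delta_mx 0 i] is the chi^+ half of the gradient of chi^+_i itself, not of its logarithm, hence
    the factor [chi_p i x]. *)
Lemma log_chi_p_alpha_m i j :
  ((delta_mx 0 i : 'rV_r) *m B *m (log_alpha_m j)^T) 0 0 =
  - 2 * chi_p i x * q i j.
Proof.
(* Spreading the lone term over k with a Kronecker delta lets the identity be checked summand by
   summand. *)
rewrite /q; have -> : 2 * ((d i)%:R * (A i j)%:~R) =
    \sum_k (k == j)%:R * (2 * ((d i)%:R * (A i k)%:~R)) :> K.
  rewrite (bigD1 j) //= eqxx mul1r big1 ?addr0 // => k /negbTE->.
  by rewrite mul0r.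
rewrite -big_split mulr_sumr -rowE mxE /=; apply: eq_bigr => k _.
rewrite !mxE -(symK i k).
have := subr_chi_m_neq0 k; have := chi_m_neq0 k.
by move=> y0 y1 /=; field; rewrite y0 y1.
Qed.

(** A 1 x 1 matrix equals its transpose, so both terms can have a chi^+ half on the left of [B]; the
    antisymmetry of the pairing becomes visible. *)
Lemma chi_tensor_pairing_comm (a b a' b' : 'rV[K]_r) :
  (row_mx a b *m chi_tensor A d x *m (row_mx a' b')^T) 0 0 =
  (a *m B *m b'^T) 0 0 - (a' *m B *m b^T) 0 0.
Proof.
rewrite chi_tensor_pairing mxE; congr (_ + _); rewrite mxE; congr (- _).
by rewrite -[a' *m B *m b^T]trmxK [RHS]mxE !trmx_mul trmxK mulmxA.
Qed.

Lemma log_pairing_mm i j :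
  (row_mx (- ((chi_p i x)^-1 *: delta_mx 0 i)) (log_alpha_m i)
     *m chi_tensor A d x
     *m (row_mx (- ((chi_p j x)^-1 *: delta_mx 0 j)) (log_alpha_m j))^T) 0 0 = 0.
Proof.
have pm k l : (- ((chi_p k x)^-1 *: delta_mx 0 k : 'rV_r) *m B
                *m (log_alpha_m l)^T) 0 0 = 2 * q k l.
  rewrite !mulNmx -!scalemxAl mxE [X in - X]mxE log_chi_p_alpha_m.
  by field; rewrite chi_p_neq0.
by rewrite chi_tensor_pairing_comm !pm qC subrr.
Qed.

Lemma log_pairing_pp i j :
  (row_mx 0 (log_alpha_p i) *m chi_tensor A d x
     *m (row_mx 0 (log_alpha_p j))^T) 0 0 = 0.
Proof. by rewrite chi_tensor_pairing_comm !mul0mx mxE subr0. Qed.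

Lemma log_pairing_mp i j :
  (row_mx (- ((chi_p j x)^-1 *: delta_mx 0 j)) (log_alpha_m j)
     *m chi_tensor A d x *m (row_mx 0 (log_alpha_p i))^T) 0 0 =
  2 * (d i)%:R * (A i j)%:~R.
Proof.
rewrite chi_tensor_pairing_comm !mul0mx [X in _ - X]mxE subr0.
rewrite !mulNmx -!scalemxAl [(_ *: _)^T]linearZ /= -scalemxAr.
rewrite -rowE trmx_delta -colE !mxE -[2 * _ * _]mulrA symK.
by field; rewrite chi_p_neq0 chi_m_neq0.
Qed.

Lemma log_pairing_pm i j :
  (row_mx 0 (log_alpha_p i) *m chi_tensor A d x
     *m (row_mx (- ((chi_p j x)^-1 *: delta_mx 0 j)) (log_alpha_m j))^T) 0 0 =
  - 2 * (d i)%:R * (A i j)%:~R.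
Proof.
(* Antisymmetry reduces this to [log_pairing_mp]. *)
rewrite chi_tensor_pairing_comm -opprB -chi_tensor_pairing_comm.
by rewrite log_pairing_mp; ring.
Qed.

(** The logarithmic pairings are the constants 0 and -b, b of the original coordinates; multiplying
    by the two component values gives the tensor at the image point. *)
Lemma alpha_map_bracket (c e : 'I_(r + r)) :
  poisson_bracket (chi_tensor A d) (fun y => alpha_map A y 0 c)
    (fun y => alpha_map A y 0 e) x = chi_tensor A d (alpha_map A x) c e.
Proof.
rewrite -(splitK c) -(splitK e).
case: (fintype.split c) => i; case: (fintype.split e) => j /=.
- rewrite (log_grad_bracket _ (log_grad_alpha_p i) (log_grad_alpha_p j)).
  by rewrite log_pairing_pp block_mxEul [RHS]mxE mulr0.
- rewrite (log_grad_bracket _ (log_grad_alpha_p i) (log_grad_alpha_m j)).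
  by rewrite log_pairing_pm block_mxEur [RHS]mxE mulrC !mulrA.
- rewrite (log_grad_bracket _ (log_grad_alpha_m i) (log_grad_alpha_p j)).
  rewrite log_pairing_mp block_mxEdl [RHS]mxE [X in - X]mxE [X in - X]mxE.
  by rewrite /chi_p /chi_m; ring.
- rewrite (log_grad_bracket _ (log_grad_alpha_m i) (log_grad_alpha_m j)).
  by rewrite log_pairing_mm block_mxEdr [RHS]mxE mulr0.
Qed.

Lemma alpha_map_differentiable (c : 'I_(r + r)) :
  differentiable (fun y => alpha_map A y 0 c) x.
Proof.
rewrite -(splitK c); case: (fintype.split c) => i /=.
  by case: (log_grad_alpha_p i).
by case: (log_grad_alpha_m i).
Qed.

End ChiMutation.

Theorem corollary2 (R : realType) (r : nat) (A : 'M[int]_r) (d : 'I_r -> nat)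
    (hA : simple_cartan_matrix R[i] A)
    (d_gt0 : forall i, (0 < d i)%N)
    (d_coprime : \big[gcdn/0%N]_(i < r) d i = 1%N)
    (d_sym : forall i j, (d i)%:Z * A i j = (d j)%:Z * A j i) :
  poisson_map (chi_tensor A d) (@alpha_domain R[i] r) (@torus R[i] r)
    (alpha_map A).
Proof.
apply: poisson_map_coord => x Ux.
- exact: alpha_map_torus.
- exact: alpha_map_differentiable.
- exact: alpha_map_bracket.
Qed.
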